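(* In the online maximum-weight perfect matching problem with i.i.d. arrivals (defined below), the max-weight variant of FAIR-BIAS (defined below) is $\tfrac12$-competitive: $\mathbb{E}[\mathrm{ALG}]\ge\tfrac12\,\mathbb{E}[\mathrm{OPT}]$.
   Context: Problem: a set $S$ of $n$ servers, a finite set $R$ of request types with known probabilities $p_r>0$, $\sum_{r\in R}p_r=1$, and nonnegative weights $w_{s,r}$ for $s\in S$, $r\in R$. $n$ requests arrive one at a time, each of type drawn independently according to $(p_r)$; each must be immediately and irrevocably matched to a currently free server, gaining the corresponding weight. $\mathrm{ALG}$ is the total weight obtained and $\mathrm{OPT}$ the weight of an offline maximum-weight perfect matching between the realized requests and the servers. For $T\subseteq S$ nonempty, $M(T)$ is the LP: maximize $\sum_{s\in T,r\in R}w_{s,r}x_{s,r}$ subject to $\sum_{r\in R}x_{s,r}=1/|T|$ for all $s\in T$, $\sum_{s\in T}x_{s,r}=p_r$ for all $r\in R$, $x\ge0$. Max-weight variant of FAIR-BIAS: set $S_n=S$; for $k=n,\dots,1$: compute an optimal solution $x^{S_k}$ of $M(S_k)$; when the $k$-th-from-last request, of type $r$, arrives, choose $s\in S_k$ with probability $x^{S_k}_{s,r}/p_r$, match the request to $s$, and set $S_{k-1}=S_k\setminus\{s\}$. *)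

(* Defs.v *)
From HB Require Import structures.
From mathcomp Require Import all_boot all_order all_algebra.

Set Implicit Arguments.
Unset Strict Implicit.
Unset Printing Implicit Defensive.

Import Order.TTheory GRing.Theory Num.Theory.
Local Open Scope ring_scope.

Section OnlineMatching.

Variables (K : realFieldType) (S Req : finType).
Variables (p : Req -> K) (w : S -> Req -> K).

(* The variables of the linear program M(T) are the y s r with s in T; the
   values of y outside T are junk and are ignored everywhere below. *)
Definition lp_feasible (T : {set S}) (y : S -> Req -> K) : Prop :=
  [/\ forall s, s \in T -> \sum_(r : Req) y s r = #|T|%:R^-1,
      forall r, \sum_(s in T) y s r = p r
    & forall s r, s \in T -> 0 <= y s r].

Definition lp_value (T : {set S}) (y : S -> Req -> K) : K :=
  \sum_(s in T) \sum_(r : Req) w s r * y s r.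

Definition lp_optimal (T : {set S}) (y : S -> Req -> K) : Prop :=
  lp_feasible T y /\
  forall z, lp_feasible T z -> lp_value T z <= lp_value T y.

(* Requests are indexed by order of arrival, i = 0, ..., n - 1 with n = #|S|;
   request i is the (n - i)-th from last. *)
Definition request_seq := {ffun 'I_#|S| -> Req}.
Definition assignment := {ffun 'I_#|S| -> S}.

(* i.i.d. arrivals: the product law on request sequences. *)
Definition request_law (rho : request_seq) : K := \prod_i p (rho i).

Definition total_weight (rho : request_seq) (m : assignment) : K :=
  \sum_i w (m i) (rho i).

(* As there are as many requests as servers, the perfect matchings are the
   injective assignments.  At least one exists and the weights are nonnegative,
   so the default value 0 does not affect the maximum. *)
Definition OPT (rho : request_seq) : K :=
  \big[Num.max/0]_(m : assignment | injectiveb m) total_weight rho m.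

Definition expected_OPT : K := \sum_rho request_law rho * OPT rho.

Definition free_servers (m : assignment) (i : 'I_#|S|) : {set S} :=
  ~: [set m j | j : 'I_#|S| & (j < i)%N].

(* Probability that a request of type r is matched to s when T is the set of
   free servers, x T being the solution of M(T) used by the algorithm. *)
Definition fair_bias_choice (x : {set S} -> S -> Req -> K)
    (T : {set S}) (r : Req) (s : S) : K :=
  if s \in T then x T s r / p r else 0.

(* Conditional law of the assignment made by the algorithm given the request
   sequence: by the chain rule, the product over time of the law of each choice
   given the current request and the earlier choices. *)
Definition fair_bias_law (x : {set S} -> S -> Req -> K)
    (rho : request_seq) (m : assignment) : K :=
  \prod_i fair_bias_choice x (free_servers m i) (rho i) (m i).

Definition expected_ALG (x : {set S} -> S -> Req -> K) : K :=
  \sum_rho request_law rho *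
    \sum_m fair_bias_law x rho m * total_weight rho m.

End OnlineMatching.

(* Main.v *)
(** Write V(T) for the value of M(T) and n = #|S|.  The expected offline optimal
    matching, divided by n, is feasible for M(S), so E[OPT] <= n V(S).  The
    algorithm picks every free server with the same probability, so its
    assignment is a uniform random bijection and E[ALG] is the sum over k of
    the average of V(T) over the k-subsets T of S.  Restricting the optimal
    solution of M(S) to T and completing it shows that this average is at
    least (k / n) V(S); summing over k gives E[ALG] >= (n + 1) / 2 * V(S). *)
Require Import Defs.
From HB Require Import structures.
From mathcomp Require Import all_boot all_order all_algebra all_fingroup.
From mathcomp Require Import ring.

Set Implicit Arguments.
Unset Strict Implicit.
Unset Printing Implicit Defensive.

Import Order.TTheory GRing.Theory Num.Theory.
Local Open Scope ring_scope.

(** Absorb [g] into the factor at [i0], then exchange product and sum. The factors [q i] may depend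
    on the time and need not sum to 1, so this also covers request probabilities multiplied by the
    algorithm's choices. *)
Lemma sum_ffun_prod_coord (K : comNzRingType) (I J : finType)
    (q : I -> J -> K) (g : J -> K) (i0 : I) :
  \sum_(f : {ffun I -> J}) (\prod_i q i (f i)) * g (f i0) =
  (\sum_j q i0 j * g j) * \prod_(i | i != i0) \sum_j q i j.
Proof.
pose q' i j := q i j * (if i == i0 then g j else 1).
transitivity (\sum_(f : {ffun I -> J}) \prod_i q' i (f i)).
  apply: eq_bigr => f _; rewrite (bigD1 i0) //= [RHS](bigD1 i0) //= /q' eqxx.
  rewrite mulrAC; congr (_ * _); apply: eq_bigr => i /negPf->.
  by rewrite mulr1.
rewrite -bigA_distr_bigA (bigD1 i0) //=; congr (_ * _).
  by apply: eq_bigr => j _; rewrite /q' eqxx.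
apply: eq_bigr => i /negPf ni; apply: eq_bigr => j _.
by rewrite /q' ni mulr1.
Qed.

(** * Restricting the linear program to fewer servers *)

Section LinearProgram.

Variables (K : realFieldType) (S Req : finType).
Variables (p : Req -> K) (w : S -> Req -> K).
Hypothesis w_ge0 : forall s r, 0 <= w s r.

Lemma natr_card_neq0 (T : {set S}) : T != set0 -> #|T|%:R != 0 :> K.
Proof. by rewrite pnatr_eq0 cards_eq0. Qed.

(* Restricting [z] to [T] leaves row deficits 1/|T| - 1/|U|, all equal, so the
   residual column masses can be spread evenly over [T]; this only increases
   the value. *)
Lemma lp_optimal_sub (T U : {set S}) (y z : S -> Req -> K) :
  T != set0 -> T \subset U -> lp_optimal p w T y -> lp_feasible p U z ->
  \sum_(s in T) \sum_r w s r * z s r <= lp_value w T y.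
Proof.
move=> T0 TU [_ ymax] [zrow zcol z_ge0].
have kn0 := natr_card_neq0 T0.
have k_ge0 : 0 <= #|T|%:R^-1 :> K by rewrite invr_ge0 ler0n.
have un0 : #|U|%:R != 0 :> K.
  apply: natr_card_neq0; apply: contraNneq T0 => U0.
  by rewrite U0 subset0 in TU.
pose d r := p r - \sum_(s in T) z s r.
have d_ge0 r : 0 <= d r.
  rewrite /d -(zcol r) subr_ge0 [leRHS](big_setID T) /= (setIidPr TU) lerDl.
  by apply: sumr_ge0 => s /setDP[sU _]; apply: z_ge0.
(* Double counting the mass of [z]: by columns it is the sum of [p], by rows it is [#|U|] times
   [1/#|U|]. *)
have p_sum : \sum_r p r = 1.
  rewrite (eq_bigr _ (fun r _ => esym (zcol r))) exchange_big /=.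
  by rewrite (eq_bigr _ zrow) sumr_const -(mulr_natr #|U|%:R^-1) mulVf.
pose z' s r := z s r + #|T|%:R^-1 * d r.
apply: le_trans (ymax z' _).
  apply: ler_sum => s sT; apply: ler_sum => r _.
  by apply: ler_wpM2l => //; rewrite lerDl mulr_ge0.
split=> [s sT|r|s r sT].
- rewrite big_split /= -mulr_sumr sumrB p_sum exchange_big /=.
  rewrite zrow ?(subsetP TU) //.
  rewrite (eq_bigr (fun=> #|U|%:R^-1)) => [|t tT]; last first.
    by rewrite zrow ?(subsetP TU).
  by rewrite sumr_const -(mulr_natr #|U|%:R^-1); field; rewrite kn0.
- rewrite big_split /= sumr_const -(mulr_natl (_ * d r)) mulrA divff // mul1r.
  by rewrite addrC subrK.
- by rewrite addr_ge0 ?z_ge0 ?(subsetP TU) ?mulr_ge0.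
Qed.

End LinearProgram.

(** * Upper bound on the offline optimum *)

Section OfflineBound.

Variables (K : realFieldType) (S Req : finType).
Variables (p : Req -> K) (w : S -> Req -> K).
Hypothesis p_ge0 : forall r, 0 <= p r.
Hypothesis p_sum1 : \sum_r p r = 1.
Hypothesis w_ge0 : forall s r, 0 <= w s r.

Lemma request_law_ge0 (rho : request_seq S Req) : 0 <= request_law p rho.
Proof. by apply: prodr_ge0. Qed.

Lemma sum_request_law_coord (i : 'I_#|S|) (g : Req -> K) :
  \sum_(rho : request_seq S Req) request_law p rho * g (rho i) =
  \sum_r p r * g r.
Proof.
by rewrite (sum_ffun_prod_coord (fun=> p)) [X in _ * X]big1 ?mulr1.
Qed.

Lemma sum_request_law : \sum_(rho : request_seq S Req) request_law p rho = 1.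
Proof.
by rewrite -(bigA_distr_bigA (fun=> p)) big1.
Qed.

(** A sigma type, so that an optimal matching can be taken as a function of [rho]. Nonnegative
    weights make the default 0 of the maximum harmless. *)
Lemma OPT_attained (rho : request_seq S Req) :
  {m : assignment S | injective m & OPT w rho = total_weight w rho m}.
Proof.
pose m0 : assignment S := [ffun i => enum_val i].
have m0_inj : injectiveb m0.
  by apply/injectiveP => i j; rewrite !ffunE => /enum_val_inj.
pose m := [arg max_(m > m0 | injectiveb m) total_weight w rho m]%O.
exists m; first by rewrite /m; case: arg_maxP => // i /injectiveP.
apply: bigmax_eq_arg => // i _; exact: sumr_ge0.
Qed.

Lemma sum_inj_assignment (m : assignment S) (F : S -> K) :
  injective m -> \sum_i F (m i) = \sum_s F s.
Proof.
move=> m_inj; rewrite [RHS](reindex m) //=.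
by apply/onW_bij/inj_card_bij => //; rewrite card_ord.
Qed.

(* The expected optimal matching divided by #|S| is feasible for M(S). *)
Lemma expected_OPT_le (y : S -> Req -> K) :
  (0 < #|S|)%N -> lp_optimal p w [set: S] y ->
  expected_OPT p w <= #|S|%:R * lp_value w [set: S] y.
Proof.
move=> n_gt0 [_ ymax].
have nn0 : #|S|%:R != 0 :> K by rewrite pnatr_eq0 -lt0n.
pose mu (rho : request_seq S Req) := s2val (OPT_attained rho).
have mu_inj rho : injective (mu rho) by exact: (s2valP (OPT_attained rho)).
have mu_opt rho : OPT w rho = total_weight w rho (mu rho).
  exact: (s2valP' (OPT_attained rho)).
pose hit (rho : request_seq S Req) s r :=
  \sum_i (((mu rho i == s) && (rho i == r))%:R : K).
pose z s r := #|S|%:R^-1 * \sum_rho request_law p rho * hit rho s r.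
rewrite mulrC -ler_pdivrMr ?ltr0n // mulrC.
suff [zf ->] : lp_feasible p [set: S] z /\
    #|S|%:R^-1 * expected_OPT p w = lp_value w [set: S] z by apply: ymax.
(* Rows: each server receives exactly one request. Columns: each of the n arrivals has type [r] with
   probability [p r], and the factor 1/n averages them. *)
split; first split=> [s _|r|s r _].
- rewrite cardsT /z -mulr_sumr exchange_big /= -[RHS]mulr1; congr (_ * _).
  rewrite -sum_request_law; apply: eq_bigr => rho _.
  rewrite -mulr_sumr -[RHS]mulr1; congr (_ * _).
  rewrite exchange_big /= (eq_bigr (fun i => ((mu rho i == s)%:R : K))).
    rewrite (sum_inj_assignment (fun t => (t == s)%:R : K)) //.
    by rewrite (bigD1 s) //= eqxx big1 ?addr0 // => t /negPf->.
  move=> i _; rewrite (bigD1 (rho i)) //= eqxx andbT big1 ?addr0 // => r'.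
  by rewrite eq_sym => /negPf->; rewrite andbF.
- rewrite /z -mulr_sumr exchange_big /=.
  transitivity (#|S|%:R^-1 * \sum_(i < #|S|) p r); last first.
    by rewrite sumr_const card_ord -(mulr_natl (p r)) mulKf.
  congr (_ * _).
  transitivity (\sum_(rho : request_seq S Req) \sum_i
      request_law p rho * (rho i == r)%:R).
    apply: eq_bigr => rho _; rewrite -mulr_sumr -mulr_sumr; congr (_ * _).
    rewrite exchange_big /=; apply: eq_bigr => i _.
    rewrite (bigD1 (mu rho i)) ?inE //= eqxx /= big1 ?addr0 // => t.
    by rewrite eq_sym => /andP[_ /negPf->].
  rewrite exchange_big /=; apply: eq_bigr => i _.
  rewrite (sum_request_law_coord i (fun t => (t == r)%:R)).
  rewrite (bigD1 r) //= eqxx mulr1 big1 ?addr0 // => t /negPf->.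
  by rewrite mulr0.
- rewrite mulr_ge0 ?invr_ge0 // sumr_ge0 // => rho _.
  by rewrite mulr_ge0 ?request_law_ge0 // sumr_ge0.
- rewrite /lp_value /z.
  under [RHS]eq_bigr => s _ do under eq_bigr => r _ do rewrite mulrCA mulr_sumr.
  under [RHS]eq_bigr => s _ do rewrite -mulr_sumr exchange_big /=.
  rewrite -mulr_sumr exchange_big /=; congr (_ * _).
  apply: eq_bigr => rho _; rewrite mu_opt.
  under [RHS]eq_bigr => s _ do
    under eq_bigr => r _ do rewrite mulrCA mulr_sumr.
  under [RHS]eq_bigr => s _ do rewrite -mulr_sumr exchange_big /=.
  rewrite -mulr_sumr exchange_big /=; congr (_ * _); apply: eq_bigr => i _.
  rewrite (bigD1 (mu rho i)) ?inE //= [X in _ + X]big1 => [|s]; last first.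
    rewrite eq_sym => /andP[_ /negPf->]; rewrite big1 // => r _.
    by rewrite mulr0.
  rewrite (bigD1 (rho i)) //= !eqxx mulr1 addr0 big1 ?addr0 // => r.
  by rewrite eq_sym => /negPf->; rewrite andbF mulr0.
Qed.

End OfflineBound.

(** * Symmetries of a uniform random bijection *)

Section Symmetrisation.

Variables (K : realFieldType) (S : finType).

Lemma sum_inj_perm (F : assignment S -> K) (t : 'S_#|S|) :
  \sum_(m : assignment S | injectiveb m) F m =
  \sum_(m : assignment S | injectiveb m) F [ffun i => m (t i)].
Proof.
rewrite (reindex (fun m : assignment S => [ffun i => m (t i)])) /=; last first.
  exists (fun m : assignment S => [ffun i => m (t^-1%g i)]) => m _;
    by apply/ffunP=> i; rewrite !ffunE (permK, permKV).
apply: eq_bigl => m; apply/injectiveP/injectiveP => m_inj i j.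
  move=> e; apply: (@perm_inj _ t^-1%g); apply: m_inj.
  by rewrite !ffunE !permKV.
by rewrite !ffunE => /m_inj/perm_inj.
Qed.

(** Used in contrapositive form: a non-injective assignment picks an occupied server at some time,
    so the algorithm gives it probability 0. *)
Lemma injective_free (m : assignment S) :
  (forall i, m i \in free_servers m i) -> injective m.
Proof.
move=> mfree i j eij; apply/val_inj/eqP; case: ltngtP => // ij.
  have := mfree j; rewrite inE => /imsetP[]; exists i; by rewrite ?inE.
have := mfree i; rewrite inE => /imsetP[]; exists j; by rewrite ?inE.
Qed.

Lemma free_serversE (m : assignment S) (j : 'I_#|S|) :
  injective m -> free_servers m j = [set m k | k : 'I_#|S| & (j <= k)%N].
Proof.
move=> m_inj; apply/setP => s; rewrite inE.
have /(_ s)[k ->] : forall s, exists k, s = m k.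
  move=> {}s; have [g _ gK] : bijective m.
    by apply: inj_card_bij => //; rewrite card_ord.
  by exists (g s).
by rewrite !mem_imset // !inE -leqNgt.
Qed.

Lemma sum_free_servers (m : assignment S) (j : 'I_#|S|) (F : S -> K) :
  injective m ->
  \sum_(s in free_servers m j) F s = \sum_(k < #|S| | (j <= k)%N) F (m k).
Proof.
move=> m_inj; rewrite free_serversE // big_imset /=.
  by apply: eq_bigl => k; rewrite inE.
by move=> ? ? _ _ /m_inj.
Qed.

Lemma card_ord_ge n (j : 'I_n) : #|[pred k : 'I_n | (j <= k)%N]| = (n - j)%N.
Proof.
rewrite -sum1_card -(big_geq_mkord _ _ predT (fun=> 1%N)).
by rewrite sum_nat_const_nat muln1.
Qed.

Lemma card_free_servers (m : assignment S) (j : 'I_#|S|) :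
  injective m -> #|free_servers m j| = (#|S| - j)%N.
Proof.
by move=> m_inj; rewrite free_serversE // card_imset // cardsE card_ord_ge.
Qed.

Lemma free_servers_tperm (m : assignment S) (j k : 'I_#|S|) :
  (j <= k)%N ->
  free_servers [ffun i => m (tperm j k i)] j = free_servers m j.
Proof.
move=> jk; congr (~: _); apply: eq_in_imset => i; rewrite inE => ij.
rewrite ffunE tpermD // -val_eqE /=; first by rewrite gtn_eqF.
by rewrite gtn_eqF // (leq_trans ij).
Qed.

(* Conditionally on the set of free servers, each of them is equally likely
   to come next. *)
Lemma sum_inj_free (j : 'I_#|S|) (g : {set S} -> S -> K) :
  \sum_(m : assignment S | injectiveb m)
     (#|S| - j)%:R * g (free_servers m j) (m j) =
  \sum_(m : assignment S | injectiveb m)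
     \sum_(s in free_servers m j) g (free_servers m j) s.
Proof.
(* Swapping times [j] and [k >= j] leaves the free set at time [j] unchanged, so the n - j inner
   sums all agree. *)
transitivity (\sum_(k < #|S| | (j <= k)%N)
    \sum_(m : assignment S | injectiveb m) g (free_servers m j) (m k)).
  rewrite [RHS](eq_bigr (fun=> \sum_(m : assignment S | injectiveb m)
      g (free_servers m j) (m j))) => [|k jk].
    rewrite -mulr_sumr sumr_const -[RHS]mulr_natl; congr (_%:R * _).
    exact: esym (card_ord_ge j).
  rewrite [LHS](sum_inj_perm _ (tperm j k)); apply: eq_bigr => m _.
  by rewrite free_servers_tperm // ffunE tpermR.
rewrite exchange_big /=; apply: eq_bigr => m /injectiveP m_inj.
by rewrite sum_free_servers.
Qed.

(** Each [m k] is uniform on [S], in division-free form: by transpositions all n positions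
    contribute equally, and together they give the sum of [v] for each of the n! bijections. *)
Lemma sum_inj_coord (k : 'I_#|S|) (v : S -> K) :
  #|S|%:R * \sum_(m : assignment S | injectiveb m) v (m k) =
  #|S|`!%:R * \sum_s v s.
Proof.
transitivity (\sum_(i < #|S|)
    \sum_(m : assignment S | injectiveb m) v (m i)).
  rewrite [RHS](eq_bigr (fun=>
      \sum_(m : assignment S | injectiveb m) v (m k))).
    by rewrite sumr_const card_ord mulr_natl.
  move=> i _; rewrite [LHS](sum_inj_perm _ (tperm k i)).
  by apply: eq_bigr => m _; rewrite ffunE tpermR.
rewrite exchange_big /= (eq_bigr (fun=> \sum_s v s)) => [|m /injectiveP].
  rewrite sumr_const mulr_natl; congr (_ *+ _).
  have := card_inj_ffuns 'I_#|S| S.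
  by rewrite card_ord ffactnn cardsE.
exact: sum_inj_assignment.
Qed.

End Symmetrisation.

(** * Expected gain of the algorithm *)

Section FairBias.

Variables (K : realFieldType) (S Req : finType).
Variables (p : Req -> K) (w : S -> Req -> K) (x : {set S} -> S -> Req -> K).
Hypothesis p_gt0 : forall r, 0 < p r.
Hypothesis w_ge0 : forall s r, 0 <= w s r.
Hypothesis x_opt : forall T : {set S}, T != set0 -> lp_optimal p w T (x T).

(** For [s] in [T], the expected weight earned on the event that [s] is chosen when [T] is free: the
    arrival probability [p r] cancels the denominator of the choice rule. *)
Let gain (T : {set S}) (s : S) : K := \sum_r w s r * x T s r.

Lemma sum_choice_free (T : {set S}) (s : S) (h : Req -> K) : s \in T ->
  \sum_r p r * fair_bias_choice p x T r s * h r = \sum_r h r * x T s r.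
Proof.
move=> sT; apply: eq_bigr => r _; rewrite /fair_bias_choice sT.
by rewrite mulrCA divff ?mulr1 ?lt0r_neq0 // mulrC.
Qed.

Lemma prod_free_card : \prod_(i < #|S|) (#|S| - i)%:R = #|S|`!%:R :> K.
Proof. by rewrite -natr_prod -ffact_prod ffactnn. Qed.

(** For fixed [m] the free sets do not depend on [rho], so the sum factorises over time. Time [j]
    contributes the gain and every other time [i] the row sum 1/(n - i); against n!, only the factor
    n - j survives. A choice of an occupied server makes a factor vanish. *)
Lemma sum_law_weight (m : assignment S) (j : 'I_#|S|) :
  #|S|`!%:R * \sum_(rho : request_seq S Req)
     request_law p rho * fair_bias_law p x rho m * w (m j) (rho j) =
  if injectiveb m then (#|S| - j)%:R * gain (free_servers m j) (m j) else 0.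
Proof.
pose q i r := p r * fair_bias_choice p x (free_servers m i) r (m i).
under eq_bigr do rewrite -big_split /=.
rewrite (sum_ffun_prod_coord q _ j).
case: injectiveP => [m_inj|m_ninj]; last first.
  have [i /negPf mi] : exists i, m i \notin free_servers m i.
    apply/existsP; apply: contra_notT m_ninj; rewrite negb_exists => /forallP h.
    by apply: injective_free => i; move: (h i); rewrite negbK.
  have q0 r : q i r = 0 by rewrite /q /fair_bias_choice mi mulr0.
  have [->|ij] := eqVneq j i.
    by rewrite big1 ?mul0r ?mulr0 // => r _; rewrite q0 mul0r.
  rewrite [X in _ * (_ * X)](bigD1 i) 1?eq_sym //=.
  by rewrite [X in _ * (_ * (X * _))]big1 ?mul0r ?mulr0.
have free i : m i \in free_servers m i.
  by rewrite free_serversE // imset_f ?inE.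
have n_neq0 (i : 'I_#|S|) : (#|S| - i)%:R != 0 :> K.
  by rewrite pnatr_eq0 -lt0n subn_gt0.
rewrite sum_choice_free // -/(gain _ _) -prod_free_card (bigD1 j) //=.
rewrite [X in _ * (_ * X)](eq_bigr (fun i : 'I__ =>
  (#|S| - i)%:R^-1)); last first.
  move=> i _; under eq_bigr do rewrite -[q i _]mulr1.
  rewrite sum_choice_free //.
  under eq_bigr do rewrite mul1r.
  have [|[rowE _ _] _] := x_opt (T := free_servers m i).
    by apply/set0Pn; exists (m i).
  by rewrite rowE // card_free_servers.
by rewrite prodfV mulrACA divff ?mulr1 //; apply/prodf_neq0.
Qed.

(** The innermost sum is the optimum of the linear program on the current free set, which is thus
    the mean reward of each arrival. *)
Lemma expected_ALGE :
  #|S|`!%:R * expected_ALG p w x =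
  \sum_(j < #|S|) \sum_(m : assignment S | injectiveb m)
     \sum_(s in free_servers m j) gain (free_servers m j) s.
Proof.
transitivity (\sum_(j < #|S|) \sum_(m : assignment S)
   if injectiveb m then (#|S| - j)%:R * gain (free_servers m j) (m j) else 0).
  rewrite /expected_ALG.
  under eq_bigr => rho _.
    rewrite mulr_sumr.
    under eq_bigr => m _ do rewrite /total_weight mulrA mulr_sumr.
    rewrite exchange_big /=; over.
  rewrite exchange_big /= mulr_sumr; apply: eq_bigr => j _.
  rewrite exchange_big /= mulr_sumr; apply: eq_bigr => m _.
  exact: sum_law_weight.
apply: eq_bigr => j _; rewrite -big_mkcond /=.
exact: sum_inj_free.
Qed.

Lemma expected_ALG_ge :
  (0 < #|S|)%N ->
  #|S|.+1%:R * lp_value w [set: S] (x [set: S]) <= 2 * expected_ALG p w x.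
Proof.
move=> n_gt0; set V := lp_value _ _ _.
have fact_gt0R : 0 < #|S|`!%:R :> K by rewrite ltr0n fact_gt0.
have S_n0 : [set: S] != set0 by rewrite -card_gt0 cardsT.
have [V_f _] := x_opt S_n0.
have V_sum : \sum_s gain [set: S] s = V.
  by apply: eq_bigl => s; rewrite inE.
(* Arrival [j] earns at least (n - j)/n times [V] on average: the solution for all of [S],
   restricted to a random free set of size n - j, has exactly this mean value. *)
have step (j : 'I_#|S|) : (#|S| - j)%:R * (#|S|`!%:R * V) <=
    #|S|%:R * \sum_(m : assignment S | injectiveb m)
      \sum_(s in free_servers m j) gain (free_servers m j) s.
  apply: (@le_trans _ _ (#|S|%:R * \sum_(m : assignment S | injectiveb m)
      \sum_(s in free_servers m j) gain [set: S] s)).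
    rewrite [X in _ <= _ * X](eq_bigr (fun m : assignment S =>
      \sum_(k < #|S| | (j <= k)%N) gain [set: S] (m k))); last first.
      by move=> m /injectiveP m_inj; rewrite sum_free_servers.
    rewrite exchange_big /= [leRHS]mulr_sumr.
    rewrite [leRHS](eq_bigr (fun=> #|S|`!%:R * V)) => [|k _]; last first.
      by rewrite sum_inj_coord V_sum.
    by rewrite sumr_const -[leRHS]mulr_natl card_ord_ge.
  rewrite ler_wpM2l // ler_sum // => m /injectiveP m_inj.
  have T0 : free_servers m j != set0.
    by rewrite -card_gt0 card_free_servers // subn_gt0.
  exact: (lp_optimal_sub w_ge0 T0 (subsetT _) (x_opt T0) V_f).
have nfact_gt0 : 0 < #|S|%:R * #|S|`!%:R :> K by rewrite mulr_gt0 // ltr0n.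
have sumE : 2 * \sum_(j < #|S|) (#|S| - j)%:R = #|S|%:R * #|S|.+1%:R :> K.
  rewrite -natr_sum -!natrM; congr _%:R; elim: #|S| => [|n IHn].
    by rewrite big_ord0.
  rewrite big_ord_recl subn0 mulnDr.
  by under eq_bigr do rewrite subSS; rewrite IHn -mulnDl mulnC.
rewrite -(ler_pM2l nfact_gt0).
have -> : #|S|%:R * #|S|`!%:R * (#|S|.+1%:R * V) =
    2 * \sum_(j < #|S|) (#|S| - j)%:R * (#|S|`!%:R * V).
  by rewrite -mulr_suml [RHS]mulrA sumE; ring.
have -> : #|S|%:R * #|S|`!%:R * (2 * expected_ALG p w x) =
    2 * (#|S|%:R * (#|S|`!%:R * expected_ALG p w x)) by ring.
by rewrite ler_pM2l // expected_ALGE [leRHS]mulr_sumr ler_sum.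
Qed.

End FairBias.

Theorem theorem5 (K : realFieldType) (S Req : finType)
    (p : Req -> K) (w : S -> Req -> K) (x : {set S} -> S -> Req -> K)
    (p_gt0 : forall r, 0 < p r) (p_sum1 : \sum_(r : Req) p r = 1)
    (w_ge0 : forall s r, 0 <= w s r)
    (x_opt : forall T : {set S}, T != set0 -> lp_optimal p w T (x T)) :
  expected_ALG p w x >= 2^-1 * expected_OPT p w.
Proof.
have p_ge0 r : 0 <= p r by rewrite ltW.
(* Without servers [x_opt] says nothing about the full set, but every total weight is an empty
   sum. *)
have [S0|n_gt0] := posnP #|S|.
  have w0 rho m : total_weight w rho m = 0.
    by apply: big1 => -[i hi] _; exfalso; rewrite S0 in hi.
  have -> : expected_OPT p w = 0.
    apply: big1 => rho _; have [m _ ->] := OPT_attained w_ge0 rho.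
    by rewrite w0 mulr0.
  rewrite mulr0 sumr_ge0 // => rho _.
  by rewrite big1 ?mulr0 // => m _; rewrite w0 mulr0.
have S_n0 : [set: S] != set0 by rewrite -card_gt0 cardsT.
have [V_f _] := x_opt _ S_n0.
have O_le := expected_OPT_le p_ge0 p_sum1 w_ge0 n_gt0 (x_opt _ S_n0).
have A_ge := expected_ALG_ge p_gt0 w_ge0 x_opt n_gt0.
have V_ge0 : 0 <= lp_value w [set: S] (x [set: S]).
  case: V_f => _ _ x_ge0; apply: sumr_ge0 => s sS; apply: sumr_ge0 => r _.
  by rewrite mulr_ge0 ?x_ge0.
(* The two bounds meet with room to spare: n against n + 1 times the value of the full program. *)
rewrite ler_pdivrMl ?ltr0n //; apply: le_trans O_le (le_trans _ A_ge).
by rewrite ler_wpM2r // ler_nat.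
Qed.
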